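(* Let $n\ge 1$ be an integer, let $C$ be a nonempty convex subset of $\mathbb{R}^n$ and let $f:C\to\mathbb{R}$ be convex. Let $\lambda=(\lambda_1,\dots,\lambda_n)\in \mathrm{int}(E_n)$, put $\lambda_{n+1}:=1-\sum_{i=1}^n\lambda_i$ and $\alpha_i:=\lambda_{n+1}/\lambda_i$ for $i=1,\dots,n$, and let $\mu_\lambda$ be the probability measure on $E_n$ defined by $$d\mu_\lambda(t):=\frac{\sum_{i=1}^n\alpha_i^{-1}}{B_n(\alpha_1^{-1},\dots,\alpha_n^{-1})}\prod_{i=1}^n t_i^{\alpha_i^{-1}-1}\,dt .$$ Then for all $(a_1,\dots,a_{n+1})\in C^{n+1}$, $$f\Big(\sum_{i=1}^{n+1}\lambda_ia_i\Big)\le\int_{E_n}f\Big(\sum_{i=1}^{n+1}t_ia_i\Big)\,d\mu_\lambda(t)\le\sum_{i=1}^{n+1}\lambda_if(a_i).$$ If instead $f$ is concave, both inequalities are reversed.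
   Context: $E_n:=\{(t_1,\dots,t_n)\in\mathbb{R}^n: t_i\ge 0\ (i=1,\dots,n),\ \sum_{i=1}^n t_i\le 1\}$ is the standard simplex, and $\mathrm{int}(E_n)=\{(t_1,\dots,t_n): t_i>0\ (i=1,\dots,n),\ \sum_{i=1}^n t_i<1\}$ is its interior. For $t=(t_1,\dots,t_n)\in E_n$, $t_{n+1}:=1-\sum_{i=1}^n t_i$, and $dt:=dt_1\cdots dt_n$ is Lebesgue measure on $\mathbb{R}^n$. $B_n$ is the multivariate beta function: for $x_1,\dots,x_n>0$, $B_n(x_1,\dots,x_n)=\dfrac{\prod_{i=1}^n\Gamma(x_i)}{\Gamma(\sum_{i=1}^n x_i)}$ (for $n\ge2$ this equals $\int_{E_{n-1}}\prod_{i=1}^{n}s_i^{x_i-1}\,ds_1\cdots ds_{n-1}$ with $s_n:=1-\sum_{i=1}^{n-1}s_i$; for $n=1$ it equals $1$). *)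

(* Defs.v *)
From HB Require Import structures.
From mathcomp Require Import all_boot all_order all_algebra.
From mathcomp Require Import all_classical all_reals all_analysis.
From mathcomp Require Import measurable_realfun.

Set Implicit Arguments.
Unset Strict Implicit.
Unset Printing Implicit Defensive.

Import Order.TTheory GRing.Theory Num.Theory.
Import numFieldNormedType.Exports.

Local Open Scope classical_set_scope.
Local Open Scope ring_scope.
Local Open Scope convex_scope.

(* [convex_function] with the inequality reversed *)
Definition concave_function (R : numFieldType) (E : lmodType R)
    (E' := convex_lmodType E) (D : set E') (f : E' -> R^o) :=
  forall t : {i01 R},
    {in D &, forall x y : E', (f x <| t |> f y) <= f (x <| t |> y)}.

Section lebesgue_cons.
Context {R : realType} (n : nat).
Variable m : {sigma_finite_measure set (n.-tuple R) -> \bar R}.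

Definition cons_pair (p : measurableTypeR R * n.-tuple R) : n.+1.-tuple R :=
  [the n.+1.-tuple R of (p.1 : R) :: p.2].

Lemma measurable_cons_pair :
  measurable_fun [set: measurableTypeR R * n.-tuple R] cons_pair.
Proof.
apply: (@measurable_cons _ _ _ R
  (fun p : measurableTypeR R * n.-tuple R => p.1 : R) n snd).
- exact: (@measurable_fst _ _ (measurableTypeR R) (n.-tuple R)).
- exact: measurable_snd.
Qed.

Definition lebesgue_cons : set (n.+1.-tuple R) -> \bar R :=
  pushforward (@lebesgue_measure R \x m)%E cons_pair.

HB.instance Definition _ := Measure.copy lebesgue_cons
  (measure_function_pushforward__canonical__measure_function_Measure
     (@lebesgue_measure R \x m)%E measurable_cons_pair).

Let lebesgue_cons_sigma_finite : sigma_finite setT lebesgue_cons.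
Proof.
have /sigma_finiteP[F [TF ndF Foo]] := sigma_finiteT (@lebesgue_measure R).
have /sigma_finiteP[G [TG ndG Goo]] := sigma_finiteT m.
pose H k : set (n.+1.-tuple R) :=
  [set t | F k (thead t) /\ G k [tuple of behead t]].
exists H.
  apply/esym/seteqP; split => // t _.
  have [i _ Fi] : (\bigcup_i F i) (thead t) by rewrite -TF.
  have [j _ Gj] : (\bigcup_i G i) [tuple of behead t] by rewrite -TG.
  exists (maxn i j) => //; split.
  - by move: (thead t) Fi; exact/subsetPset/ndF/leq_maxl.
  - by move: [tuple of behead t] Gj; exact/subsetPset/ndG/leq_maxr.
move=> k; have [mF lF] := Foo k; have [mG lG] := Goo k; split.
  apply: measurableI.
  - rewrite -[X in measurable X]setTI.
    exact: (@measurable_tnth _ R n.+1 ord0).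
  - rewrite -[X in measurable X]setTI.
    exact: (@measurable_behead _ R n).
rewrite /lebesgue_cons /pushforward (_ : _ @^-1` _ = F k `*` G k).
  by rewrite product_measure1E// lte_mul_pinfty// ge0_fin_numE.
apply/seteqP; split => -[x t] /= [].
- by rewrite theadE => Fx; rewrite (_ : [tuple of _] = t)//; exact/val_inj.
- by move=> Fx Gt; split; rewrite ?theadE//=; rewrite (_ : [tuple of _] = t)//; exact/val_inj.
Qed.

HB.instance Definition _ := Measure_isSigmaFinite.Build _ _ _ lebesgue_cons
  lebesgue_cons_sigma_finite.

End lebesgue_cons.
Arguments lebesgue_cons {R n}.

(* Lebesgue measure on R^n (on its Borel sets, R^n being represented by
   n-tuples), as an iterated product of the one on R: see [lebesgue_tuple_box]. *)
Fixpoint lebesgue_tuple {R : realType} (n : nat) :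
    {sigma_finite_measure set (n.-tuple R) -> \bar R} :=
  match n with
  | 0 => dirac [tuple]
  | n'.+1 => lebesgue_cons (lebesgue_tuple n')
  end.

Lemma lebesgue_tuple_box {R : realType} n (A : 'I_n -> set R) :
  (forall i, measurable (A i)) ->
  lebesgue_tuple n [set t | forall i, A i (tnth t i)] =
    (\prod_i lebesgue_measure (A i))%E.
Proof.
elim: n A => [|n IHn] A mA.
  rewrite big_ord0 /= diracE mem_set//= => i; by case: i.
rewrite big_ord_recl -IHn// /= /lebesgue_cons /pushforward.
rewrite -product_measure1E//; last first.
  rewrite (_ : mkset _ = \bigcap_(i in [set: 'I_n])
     ((@tnth n R)^~ i @^-1` (A (lift ord0 i)))); last first.
    apply/seteqP; split => t /=; first by move=> h i _; exact: h.
    by move=> h i; exact: h.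
  apply: fin_bigcap_measurable => // i _.
  by rewrite -[X in measurable X]setTI; exact: measurable_tnth.
- exact: (mA ord0).
apply: (congr1 (product_measure1 _ _)); apply/seteqP; split => -[x t] /=.
- move=> h; split; first by have := h ord0.
  by move=> i; have := h (lift ord0 i); rewrite tnthS.
- move=> [hx ht] i; case: (unliftP ord0 i) => [j|] ->//.
  by rewrite tnthS.
Qed.

Section simplex.
Context {R : realType} (n : nat).
Implicit Types t : n.-tuple R.

Definition simplex : set (n.-tuple R) :=
  [set t | (forall i, 0 <= tnth t i) /\ \sum_(i < n) tnth t i <= 1].

Definition int_simplex : set (n.-tuple R) :=
  [set t | (forall i, 0 < tnth t i) /\ \sum_(i < n) tnth t i < 1].

(* (t_1, ..., t_n, t_{n+1}) with t_{n+1} = 1 - (t_1 + ... + t_n) *)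
Definition bary t (i : 'I_n.+1) : R :=
  if unlift ord_max i is Some j then tnth t j else 1 - \sum_(j < n) tnth t j.

Lemma measurable_simplex : measurable simplex.
Proof.
rewrite (_ : simplex = (\bigcap_(i in [set: 'I_n])
   ((@tnth n R)^~ i @^-1` `[0, +oo[%classic)) `&`
   ((fun t => \sum_(i < n) tnth t i) @^-1` `]-oo, 1]%classic)); last first.
  apply/seteqP; split => t /= [h1 h2]; split => //.
  - by move=> i _ /=; rewrite in_itv /= andbT.
  - by move=> i; have := h1 i Logic.I; rewrite /= in_itv /= andbT.
apply: measurableI.
  apply: fin_bigcap_measurable => // i _.
  by rewrite -[X in measurable X]setTI; exact: measurable_tnth.
rewrite -[X in measurable X]setTI.
suff : measurable_fun [set: n.-tuple R] (fun t => \sum_(i < n) tnth t i).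
  by apply => //; exact: measurable_itv.
by apply: measurable_sum => i; exact: measurable_tnth.
Qed.

End simplex.
Arguments simplex {R}.
Arguments int_simplex {R}.

Section beta.
Context {R : realType}.

Definition Gamma (x : R) : R :=
  \int[lebesgue_measure]_(t in `]0, +oo[) (t `^ (x - 1) * expR (- t)).

Definition multi_beta n (x : 'I_n -> R) : R :=
  (\prod_(i < n) Gamma (x i)) / Gamma (\sum_(i < n) x i).

Lemma Gamma_ge0 x : 0 <= Gamma x.
Proof. by apply: Rintegral_ge0 => t _; rewrite mulr_ge0// ?powR_ge0 ?expR_ge0. Qed.

Lemma multi_beta_ge0 n (x : 'I_n -> R) : 0 <= multi_beta x.
Proof.
by rewrite divr_ge0 ?Gamma_ge0//; apply: prodr_ge0 => i _; exact: Gamma_ge0.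
Qed.

End beta.

Section mu_lambda.
Context {R : realType} (n : nat) (l : n.-tuple R).

Definition alpha (i : 'I_n) : R := bary l ord_max / tnth l i.

(* With [powR], 0 `^ p = 0 for p < 0, so the density is finite everywhere; where
   it ought to be infinite (some t_i = 0) is a null set. *)
Definition mu_density (t : n.-tuple R) : R :=
  (\sum_(i < n) (alpha i)^-1) / multi_beta (fun i => (alpha i)^-1) *
  \prod_(i < n) tnth t i `^ ((alpha i)^-1 - 1).

(* The hypothesis on l makes the density nonnegative, hence [mu_lambda] a measure *)
Definition mu_lambda (hl : int_simplex n l) (A : set (n.-tuple R)) : \bar R :=
  (\int[lebesgue_tuple n]_(t in A `&` simplex n) (mu_density t)%:E)%E.

Hypothesis hl : int_simplex n l.

Lemma mu_density_ge0 t : 0 <= mu_density t.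
Proof.
have [l0 l1] := hl.
rewrite mulr_ge0//; last by apply: prodr_ge0 => i _; exact: powR_ge0.
rewrite divr_ge0 ?multi_beta_ge0//; apply: sumr_ge0 => i _.
by rewrite invr_ge0 divr_ge0 ?(ltW (l0 _))// /bary unlift_none subr_ge0 ltW.
Qed.

Lemma measurable_mu_density : measurable_fun [set: n.-tuple R] mu_density.
Proof.
apply: measurable_funM => //; apply: measurable_prod => i _.
apply: (@measurableT_comp _ _ _ _ _ _ (@powR R ^~ _)).
  exact: measurable_powR.
exact: measurable_tnth.
Qed.

Let mu_lambda0 : mu_lambda hl set0 = 0%E.
Proof. by rewrite /mu_lambda set0I integral_set0. Qed.

Let mu_lambda_ge0 A : (0 <= mu_lambda hl A)%E.
Proof. by apply: integral_ge0 => t _; rewrite lee_fin mu_density_ge0. Qed.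

Let mu_lambda_sigma_additive : semi_sigma_additive (mu_lambda hl).
Proof.
move=> F mF tF mUF; apply: cvg_toP.
  apply: ereal_nondecreasing_is_cvgn => i j ij.
  by apply: lee_sum_nneg_natr => // k _ _; exact: mu_lambda_ge0.
rewrite /mu_lambda setI_bigcupl ge0_integral_bigcup//=.
- by move=> k; apply: measurableI => //; exact: measurable_simplex.
- by apply/measurable_funTS/measurable_EFinP; exact: measurable_mu_density.
- by move=> t _; rewrite lee_fin mu_density_ge0.
- exact: trivIset_setIr.
Qed.

HB.instance Definition _ := isMeasure.Build _ _ _ (mu_lambda hl)
  mu_lambda0 mu_lambda_ge0 mu_lambda_sigma_additive.

End mu_lambda.

(* Main.v *)
(* In barycentric coordinates mu_lambda is the Dirichlet law with parameters
   (p_1, ..., p_n, 1), p_i = lambda_i / lambda_{n+1}, and its mean is lambda.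
   Write k_x for the function equal to s^(x-1) on [0, oo[ and to 0 elsewhere.
   Then k_x * k_y = B(x, y) k_{x+y}; integrated against exp(-s) this identity
   gives Gamma(x) Gamma(y) = B(x, y) Gamma(x + y), and iterated over the
   coordinates it gives Dirichlet's integral over the simplex, whence the total
   mass and the first moments of mu_lambda. The function f(sum_i t_i a_i) is
   convex on the simplex, hence measurable, it lies below the linear form
   sum_i t_i f(a_i), and above a linear form touching it at lambda; integrating
   these two linear forms gives the two inequalities. *)
From HB Require Import structures.
Require Import Defs.
From mathcomp Require Import all_boot all_order all_algebra.
From mathcomp Require Import all_classical all_reals all_analysis.
From mathcomp Require Import measurable_realfun.
From mathcomp Require Import ring lra.

Set Implicit Arguments.
Unset Strict Implicit.
Unset Printing Implicit Defensive.

Import Order.TTheory GRing.Theory Num.Theory.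
Import numFieldNormedType.Exports.

Local Open Scope classical_set_scope.
Local Open Scope ring_scope.

(** * Gamma and beta integrals *)

Section power_kernel.
Context {R : realType}.
Implicit Types x y r s : R.
Local Notation mu := (@lebesgue_measure R).

Lemma mem_set_itv (i : interval R) s : (s \in [set` i]) = (s \in i).
Proof. by apply/idP/idP => [/set_mem|si]; last exact: mem_set. Qed.

(** [r] times the image of Lebesgue measure under [s |-> r * s + a] gives []u, v]] the length
    [v - u]; uniqueness of Lebesgue measure does the rest. *)
Lemma ge0_integral_affine (f : R -> \bar R) r a : 0 < r ->
  measurable_fun [set: R] f -> (forall s, 0 <= f s)%E ->
  (\int[mu]_s f s = r%:E * \int[mu]_s f (r * s + a)%R)%E.
Proof.
move=> r0 mf f0.
pose phi : measurableTypeR R -> measurableTypeR R := fun s => r * s + a.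
have mphi : measurable_fun [set: measurableTypeR R] phi.
  by apply: measurable_funD => //; exact: measurable_funM.
pose nu := measure_function_pushforward__canonical__measure_function_Measure
     mu mphi.
have muE A : measurable A -> mu A = mscale (NngNum (ltW r0)) nu A.
  apply: lebesgue_measure_unique => //= _ [[u v]] _ <-.
  rewrite /mscale/= /pushforward.
  have -> : phi @^-1` `]u, v] = `](u - a) / r, (v - a) / r]%classic.
    apply/seteqP; split => s /=; rewrite !in_itv/= /phi.
      by rewrite ltr_pdivrMr// ler_pdivlMr// ltrBlDr lerBrDr mulrC.
    by rewrite ltr_pdivrMr// ler_pdivlMr// ltrBlDr lerBrDr mulrC.
  rewrite lebesgue_measure_itv/= lebesgue_measure_itv/= !lte_fin.
  rewrite ltr_pM2r ?invr_gt0// ltrD2r.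
  case: ifPn => // _; last by rewrite mule0.
  rewrite -!EFinD -EFinM; congr (_%:E).
  by rewrite -mulrBl mulrCA mulfV ?gt_eqF// mulr1 opprB addrA subrK.
rewrite (@eq_measure_integral _ _ _ _ (mscale (NngNum (ltW r0)) nu)); last first.
  by move=> A mA _; exact: muE.
rewrite ge0_integral_mscale//=; congr (_ * _)%E.
by rewrite (ge0_integral_pushforward mphi).
Qed.

Lemma ge0_integral_shift (f : R -> \bar R) a :
  measurable_fun [set: R] f -> (forall s, 0 <= f s)%E ->
  (\int[mu]_s f s = \int[mu]_s f (s - a)%R)%E.
Proof.
move=> mf f0; rewrite (@ge0_integral_affine _ 1 (- a))// mul1e.
by under eq_integral do rewrite mul1r.
Qed.

(** Extension by 0 lets convolutions run over the whole line. By the conventions of [powR], the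
    value at 0 is 1 if [x = 1] and 0 otherwise. *)
Definition powk x s : R := if 0 <= s then s `^ (x - 1) else 0.

Lemma powk_ge0 x s : 0 <= powk x s.
Proof. by rewrite /powk; case: ifP => // _; exact: powR_ge0. Qed.

Lemma measurable_powk x : measurable_fun [set: R] (powk x).
Proof.
apply: measurable_fun_ifT => //; exact: measurable_fun_ler.
Qed.

Lemma powk1 s : powk 1 s = (0 <= s)%R%:R.
Proof. by rewrite /powk subrr powRr0; case: ifP. Qed.

(** Extended-real valued, like [GammaE] below, so that Tonelli's theorem applies before finiteness
    is known. *)
Definition betaE x y : \bar R :=
  (\int[mu]_s (powk x s * powk y (1 - s))%:E)%E.

Lemma measurable_powk_conv x y r :
  measurable_fun [set: R] (fun s => powk x s * powk y (r - s)).
Proof.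
apply: measurable_funM; first exact: measurable_powk.
apply: (measurableT_comp (measurable_powk y)).
exact: measurable_funB.
Qed.

(* [1 <= y] matters only at [r = 0]: the left-hand side vanishes there, whereas
   [powk 1 0 = 1]. *)
Lemma powk_conv x y r : 0 < x -> 1 <= y ->
  (\int[mu]_s (powk x s * powk y (r - s))%:E = betaE x y * (powk (x + y) r)%:E)%E.
Proof.
move=> x0 y1; have [r0|r0|<-] := ltgtP 0 r.
(* Scaling [s] by [r] extracts the factors [r], [r ^ (x - 1)] and [r ^ (y - 1)], whose product is
   [r ^ (x + y - 1)]. *)
- rewrite (@ge0_integral_affine _ r 0)//; last 2 first.
  + by apply/measurable_EFinP; exact: measurable_powk_conv.
  + by move=> s; rewrite lee_fin mulr_ge0 ?powk_ge0.
  have pkM z s : powk z (r * s) = r `^ (z - 1) * powk z s.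
    rewrite /powk pmulr_rge0//; case: ifPn => s0; last by rewrite mulr0.
    by rewrite powRM// ltW.
  under eq_integral => s _.
    rewrite addr0 (_ : r - r * s = r * (1 - s)); last by ring.
    rewrite !pkM mulrACA EFinM.
    over.
  rewrite ge0_integralZl//=; last 3 first.
  + by apply/measurable_EFinP; exact: measurable_powk_conv.
  + by move=> s; rewrite lee_fin mulr_ge0 ?powk_ge0.
  + by rewrite lee_fin mulr_ge0// powR_ge0.
  rewrite muleA -EFinM muleC; congr (_ * _%:E)%E.
  rewrite /powk ltW//.
  rewrite -powRD; last by rewrite (gt_eqF r0) implybT.
  rewrite -[X in X * _](powRr1 (ltW r0)) -powRD; last by rewrite (gt_eqF r0) implybT.
  by congr (_ `^ _); ring.
- have -> : powk (x + y) r = 0 by rewrite /powk leNgt r0.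
  rewrite mule0; apply: integral0_eq => s _.
  congr EFin; rewrite /powk; case: ifPn => s0; last by rewrite mul0r.
  by rewrite subr_ge0 leNgt (lt_le_trans r0 s0) mulr0.
(* For [r = 0] the integrand can be nonzero only at [s = 0], a null set, and [x + y > 1] makes the
   right-hand side vanish too. *)
- have -> : powk (x + y) 0 = 0.
    rewrite /powk lexx powR0// gt_eqF// subr_gt0 (le_lt_trans y1)//.
    by rewrite ltrDr.
  rewrite mule0.
  rewrite -[RHS](@integral_set1 _ (fun s => (powk x s * powk y (0 - s))%:E) 0).
  rewrite [RHS]integral_mkcond; apply: eq_integral => s _.
  rewrite patchE; case: ifPn => // s0; congr EFin.
  rewrite /powk sub0r oppr_ge0.
  case: ltgtP => s0'; rewrite ?mul0r ?mulr0//.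
  by move: s0; rewrite -s0' notin_setE => /(_ (erefl _)).
Qed.

Definition GammaE x : \bar R := (\int[mu]_s (powk x s * expR (- s))%:E)%E.

Lemma measurable_powk_exp x :
  measurable_fun [set: R] (fun s => powk x s * expR (- s)).
Proof.
apply: measurable_funM; first exact: measurable_powk.
exact: measurableT_comp.
Qed.

Lemma GammaE_ge0 x : (0 <= GammaE x)%E.
Proof.
by apply: integral_ge0 => s _; rewrite lee_fin mulr_ge0 ?powk_ge0 ?expR_ge0.
Qed.

Lemma betaE_ge0 x y : (0 <= betaE x y)%E.
Proof. by apply: integral_ge0 => s _; rewrite lee_fin mulr_ge0 ?powk_ge0. Qed.

(** Tonelli for [powk x s * powk y (r - s) * expR (- r)]: integrating over [r] first and shifting by
    [s] gives the product of Gamma integrals, integrating over [s] first gives a convolution of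
    power kernels. *)
Lemma GammaE_betaE x y : 0 < x -> 1 <= y ->
  (GammaE x * GammaE y = betaE x y * GammaE (x + y))%E.
Proof.
move=> x0 y1.
pose F (p : measurableTypeR R * measurableTypeR R) : \bar R :=
  (powk x p.1 * powk y (p.2 - p.1) * expR (- p.2))%:E.
have F0 p : (0 <= F p)%E by rewrite lee_fin !mulr_ge0 ?powk_ge0 ?expR_ge0.
have mF : measurable_fun setT F.
  apply/measurable_EFinP; apply: measurable_funM; first apply: measurable_funM.
  - by apply: (measurableT_comp (measurable_powk x)).
  - by apply: (measurableT_comp (measurable_powk y)); exact: measurable_funB.
  - by apply: measurableT_comp => //; exact: measurableT_comp.
transitivity (\int[mu]_s \int[mu]_r F (s, r))%E.
  transitivity (\int[mu]_s ((powk x s * expR (- s))%:E * GammaE y))%E.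
    rewrite ge0_integralZr//.
    - by apply/measurable_EFinP; exact: measurable_powk_exp.
    - by move=> s _; rewrite lee_fin mulr_ge0 ?powk_ge0 ?expR_ge0.
    - exact: GammaE_ge0.
  apply: eq_integral => s _; rewrite /GammaE (@ge0_integral_shift _ s)//; last 2 first.
  - by apply/measurable_EFinP; exact: measurable_powk_exp.
  - by move=> r; rewrite lee_fin mulr_ge0 ?powk_ge0 ?expR_ge0.
  rewrite -ge0_integralZl//; last 3 first.
  - apply/measurable_EFinP; apply: (measurableT_comp (measurable_powk_exp y)).
    exact: measurable_funB.
  - by move=> r _; rewrite lee_fin mulr_ge0 ?powk_ge0 ?expR_ge0.
  - by rewrite lee_fin mulr_ge0 ?powk_ge0 ?expR_ge0.
  apply: eq_integral => r _; rewrite -EFinM; congr EFin => /=.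
  by rewrite mulrACA -expRD; congr (_ * expR _); ring.
rewrite fubini_tonelli// -ge0_integralZl//; last 3 first.
- by apply/measurable_EFinP; exact: measurable_powk_exp.
- by move=> r _; rewrite lee_fin mulr_ge0 ?powk_ge0 ?expR_ge0.
- exact: betaE_ge0.
apply: eq_integral => r _; rewrite EFinM muleA -powk_conv// -ge0_integralZr//.
- by apply/measurable_EFinP; exact: measurable_powk_conv.
- by move=> s _; rewrite lee_fin mulr_ge0 ?powk_ge0.
Qed.

Lemma integral_powR01 x : 0 < x ->
  (\int[mu]_(s in `]0%R, 1%R]) (s `^ (x - 1))%:E = (x^-1)%:E)%E.
Proof.
(* The integrand may blow up at 0, so the fundamental theorem of calculus is applied on
   [[1/(k+2), 1]], nondegenerate already for [k = 0], and followed by monotone convergence. *)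
move=> x0; pose F k : set R := `[k.+2%:R^-1, 1]%classic.
have FE k : (\int[mu]_(s in F k) (s `^ (x - 1))%:E =
    (x^-1 * (1 - k.+2%:R^-1 `^ x))%:E)%E.
  have k0 : 0 < k.+2%:R^-1 :> R by rewrite invr_gt0.
  rewrite /F (@continuous_FTC2 _ _ (fun s => x^-1 * s `^ x))//.
  - by rewrite powR1 mulr1 mulrBr mulr1.
  - by rewrite invf_lt1// ltr1n.
  - apply: derivable_within_continuous => s; rewrite in_itv/= => /andP[ks _].
    by apply: derivable_powR; rewrite in_itv/= andbT (lt_le_trans k0).
  - have dF (s : R) : 0 < s -> derivable (fun s => x^-1 * s `^ x) s 1.
      move=> s0; apply: derivableM => //.
      by apply: derivable_powR; rewrite in_itv/= andbT.
    have cF (s : R) : 0 < s -> {for s, continuous (fun s => x^-1 * s `^ x)}.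
      by move=> s0; apply/differentiable_continuous/derivable1_diffP/dF.
    split.
    + move=> s; rewrite in_itv/= => /andP[ks _].
      by apply: dF; exact: lt_trans ks.
    + by apply: cvg_at_right_filter; exact: cF.
    + by apply: cvg_at_left_filter; exact: cF.
  - move=> s; rewrite in_itv/= => /andP[ks _].
    have s0 : 0 < s by exact: lt_trans ks.
    rewrite derive1Ml; last by apply: derivable_powR; rewrite in_itv/= andbT.
    by rewrite powR_derive1 ?in_itv/= ?andbT// mulrA mulVf ?gt_eqF// mul1r.
have UF : `]0, 1]%classic = \bigcup_k F k.
  apply/seteqP; split => s /=.
    rewrite in_itv/= => /andP[s0 s1].
    have [k] := @ltr_add_invr _ 0 s s0; rewrite add0r => ks.
    exists k => //=; rewrite /F/= in_itv/= s1 andbT (le_trans _ (ltW ks))//.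
    by rewrite lef_pV2 ?posrE// ler_nat.
  move=> [k _]; rewrite /F/= !in_itv/= => /andP[ks ->]; rewrite andbT.
  by apply: lt_le_trans ks; rewrite invr_gt0.
have ndF : {homo F : n m / (n <= m)%N >-> (n <= m)%O}.
  move=> i j ij; apply/subsetPset => s; rewrite /F/= !in_itv/= => /andP[si ->].
  by rewrite andbT (le_trans _ si)// lef_pV2 ?posrE// ler_nat !ltnS.
have := @ge0_nondecreasing_set_cvg_integral _ (measurableTypeR R) R F
  (fun s => (s `^ (x - 1))%:E) mu ndF.
rewrite -UF => /(_ _ _ _)/cvg_lim <-//; last 3 first.
- by move=> k; exact: measurable_itv.
- by move=> k; apply/measurable_EFinP/measurable_funTS; exact: measurable_powR.
- by move=> k s _; rewrite lee_fin powR_ge0.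
under eq_fun do rewrite FE.
apply/cvg_lim => //; apply: cvg_EFin; first exact: nearW.
rewrite /comp/= -[X in _ --> X](mulr1 x^-1).
apply: cvgM; first exact: cvg_cst.
rewrite -[X in _ --> X](subr0 1); apply: cvgB; first exact: cvg_cst.
apply: ((cvg_at_rightP (fun s : R => s `^ x) 0 0).1 (powR_cvg0 x0)
  (fun k => k.+2%:R^-1)); split => [k|]; first by rewrite invr_gt0.
rewrite (cvg_shiftS (@harmonic R)); exact: cvg_harmonic.
Qed.

Lemma betaEx1 x : 0 < x -> (betaE x 1 = (x^-1)%:E)%E.
Proof.
move=> x0; rewrite -integral_powR01// integral_itv_obnd_cbnd; last first.
  by apply/measurable_EFinP/measurable_funTS; exact: measurable_powR.
rewrite [RHS]integral_mkcond; apply: eq_integral => s _.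
rewrite powk1 patchE mem_set_itv in_itv/= subr_ge0 /powk.
by case: (0 <= s); case: (s <= 1); rewrite /= ?mulr1 ?mulr0 ?mul0r.
Qed.

Lemma GammaE1 : (GammaE 1 = 1)%E.
Proof.
rewrite -(integral_exponential_pdf (@ltr01 R)); apply: eq_integral => s _.
congr EFin; rewrite powk1 /exponential_pdf patchE mem_set_itv in_itv/= andbT.
by case: ifPn => _; rewrite ?mul0r// !mul1r mulN1r.
Qed.

(** This functional equation is the case [y = 1] of the beta identity. Holding in the extended
    reals, it can serve to prove finiteness. *)
Lemma GammaES x : 0 < x -> (GammaE x = (x^-1)%:E * GammaE (x + 1))%E.
Proof. by move=> x0; rewrite -betaEx1// -GammaE_betaE// GammaE1 mule1. Qed.

(** The functional equation carries finiteness upwards: an infinite value at [n.+2] would force one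
    at [n.+1]. *)
Lemma GammaE_nat n : GammaE n.+1%:R \is a fin_num.
Proof.
elim: n => [|n]; first by rewrite GammaE1.
rewrite GammaES// natr1.
case: (GammaE n.+2%:R) (GammaE_ge0 n.+2%:R) => // _.
by rewrite gt0_muley// lte_fin invr_gt0.
Qed.

Lemma GammaE_fin_num x : 0 < x -> GammaE x \is a fin_num.
Proof.
move=> x0; rewrite GammaES// fin_numM//.
have [n xn] : exists n, x <= n%:R.
  by exists (Num.bound x); rewrite ltW//; apply: archi_boundP; exact: ltW.
rewrite ge0_fin_numE ?GammaE_ge0//.
(* After the passage to [x + 1] the power is [s ^ x] with [x > 0]: at most 1 for [s <= 1], at most
   [s ^ n] for [s > 1]. *)
apply: (@le_lt_trans _ _ (GammaE 1 + GammaE n.+1%:R)%E); last first.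
  rewrite GammaE1; apply: lte_add_pinfty; first exact: ltry.
  rewrite -ge0_fin_numE; first exact: GammaE_nat.
  exact: GammaE_ge0.
rewrite -ge0_integralD//=; last 4 first.
- by move=> s _; rewrite lee_fin mulr_ge0 ?powk_ge0 ?expR_ge0.
- by apply/measurable_EFinP; exact: measurable_powk_exp.
- by move=> s _; rewrite lee_fin mulr_ge0 ?powk_ge0 ?expR_ge0.
- by apply/measurable_EFinP; exact: measurable_powk_exp.
apply: ge0_le_integral => //=.
- by move=> s _; rewrite lee_fin mulr_ge0 ?powk_ge0 ?expR_ge0.
- by apply/measurable_EFinP; exact: measurable_powk_exp.
- apply/measurable_EFinP; apply: measurable_funD; exact: measurable_powk_exp.
move=> s _; rewrite lee_fin -mulrDl ler_wpM2r ?expR_ge0//.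
rewrite powk1 /powk; case: ifPn => // s0; rewrite ?addr0//.
rewrite addrK -natr1 addrK.
have [s1|s1] := leP s 1.
  rewrite -[leLHS]addr0 lerD ?powR_ge0// (_ : 1%:R = 1 `^ x); last by rewrite powR1.
  by apply: ge0_ler_powR => //; rewrite ?nnegrE ?ltW.
rewrite -[leLHS]add0r lerD//; apply: ler_powR => //; exact: ltW.
Qed.

Lemma GammaE_gt0 x : 0 < x -> (0 < GammaE x)%E.
Proof.
move=> x0.
(* A lower bound of the integrand on [[1, 2]], since there [s ^ (x - 1) >= 1 / s >= 1 / 2]. *)
have e0 : 0 < 2^-1 * expR (- 2) :> R by rewrite mulr_gt0 ?invr_gt0 ?expR_gt0.
apply: (@lt_le_trans _ _
  (\int[mu]_(s in `[1%R, 2%R]) (cst (2^-1 * expR (- 2))%:E s))%E).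
  rewrite integral_cst//= lebesgue_measure_itv/= lte_fin ltr1n -EFinB.
  by rewrite -EFinM lte_fin mulr_gt0// subr_gt0 ltr1n.
apply: (@le_trans _ _ (\int[mu]_(s in `[1%R, 2%R]) (powk x s * expR (- s))%:E)%E).
  apply: ge0_le_integral => //=.
  - by apply/measurable_funTS/measurable_EFinP; exact: measurable_powk_exp.
  move=> s; rewrite in_itv/= => /andP[s1 s2].
  have s0 : 0 <= s by exact: le_trans s1.
  rewrite lee_fin ler_pM ?expR_ge0 ?invr_ge0//; last by rewrite ler_expR lerN2.
  rewrite /powk s0; apply: (@le_trans _ _ (s `^ (-1))).
    by rewrite powR_inv1// lef_pV2// posrE// (lt_le_trans _ s1).
  by apply: ler_powR => //; rewrite lerBrDr addNr ltW.
apply: ge0_subset_integral => //=.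
- by apply/measurable_EFinP; exact: measurable_powk_exp.
- by move=> s _; rewrite lee_fin mulr_ge0 ?powk_ge0 ?expR_ge0.
Qed.

(** [Gamma] projects an extended integral to the reals, sending infinity to 0, so the equality rests
    on finiteness. *)
Lemma EFin_Gamma x : 0 < x -> (Gamma x)%:E = GammaE x.
Proof.
move=> x0.
suff h : (\int[mu]_(t in `]0%R, +oo[)
   (t `^ (x - 1) * expR (- t))%:E = GammaE x)%E.
  by rewrite /Gamma /Rintegral h fineK// GammaE_fin_num.
rewrite integral_itv_obnd_cbnd; last first.
  apply/measurable_EFinP/measurable_funTS/measurable_funM => //.
  exact: measurableT_comp.
rewrite [LHS]integral_mkcond; apply: eq_integral => s _.
rewrite patchE mem_set_itv in_itv/= andbT /powk.
by case: ifPn => //; rewrite mul0r.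
Qed.

Lemma Gamma_gt0 x : 0 < x -> 0 < Gamma x.
Proof. by move=> x0; rewrite -lte_fin EFin_Gamma// GammaE_gt0. Qed.

Lemma GammaD1 x : 0 < x -> Gamma (x + 1) = x * Gamma x.
Proof.
move=> x0; apply: EFin_inj.
rewrite EFinM !EFin_Gamma ?addr_gt0// (GammaES x0) muleA -EFinM.
by rewrite mulfV ?gt_eqF// mul1e.
Qed.

Lemma betaE_Gamma x y : 0 < x -> 1 <= y ->
  betaE x y = (Gamma x * Gamma y / Gamma (x + y))%:E.
Proof.
move=> x0 y1; have y0 : 0 < y by exact: lt_le_trans y1.
have xy0 : 0 < x + y by rewrite addr_gt0.
rewrite 2!EFinM !EFin_Gamma// GammaE_betaE// -(EFin_Gamma xy0) -muleA -EFinM.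
by rewrite mulfV ?mule1// gt_eqF// Gamma_gt0.
Qed.

End power_kernel.

(** * Measures with a density *)

Section density.
Local Open Scope ereal_scope.
Context d (T : measurableType d) (R : realType).
Variables (mu nu : {measure set T -> \bar R}) (D : set T) (g : T -> R).
Hypotheses (mD : measurable D) (mg : measurable_fun [set: T] g).
Hypotheses (g0 : forall t, (0 <= g t)%R).
Hypothesis nuE : forall A, measurable A -> nu A = \int[mu]_(t in A `&` D) (g t)%:E.

Import HBNNSimple.

(** By simple functions: [nuE] settles indicators, and monotone convergence on both sides settles
    the limit. It will turn integrals against [mu_lambda] into Lebesgue integrals. *)
Lemma ge0_integral_density (f : T -> \bar R) :
  measurable_fun D f -> (forall t, D t -> 0 <= f t) ->
  \int[nu]_(t in D) f t = \int[mu]_(t in D) (f t * (g t)%:E).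
Proof.
move=> mf f0; pose h := nnsfun_approx mD mf.
have hf t : D t -> (h k t)%:E @[k --> \oo] --> f t.
  by move=> Dt; apply: cvg_nnsfun_approx.
have ndh t : {homo (fun k => h k t) : k l / (k <= l)%N >-> (k <= l)%R}.
  by move=> k l kl; exact/lefP/nd_nnsfun_approx.
transitivity (limn (fun k => \int[nu]_(t in D) (h k t)%:E)).
  rewrite -monotone_convergence//.
  - by apply: eq_integral => t /set_mem Dt; apply/esym/cvg_lim => //; exact: hf.
  - by move=> k; apply/measurable_EFinP/measurable_funTS.
  - by move=> k t _; rewrite lee_fin.
  - by move=> t _ k l kl; rewrite lee_fin ndh.
transitivity (limn (fun k => \int[mu]_(t in D) ((h k t)%:E * (g t)%:E))); last first.
  rewrite -monotone_convergence//.
  - apply: eq_integral => t /set_mem Dt; apply/cvg_lim => //.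
    by apply: cvgeZr => //; exact: hf.
  - move=> k; apply: emeasurable_funM; apply/measurable_EFinP.
      exact/measurable_funTS.
    exact: measurable_funTS.
  - by move=> k t _; rewrite -EFinM lee_fin mulr_ge0.
  - by move=> t _ k l kl; rewrite -!EFinM lee_fin ler_wpM2r// ndh.
congr (limn _); apply/funext => k.
have mind r : measurable_fun D (fun t => (r * \1_(h k @^-1` [set r]) t)%:E).
  by apply/measurable_EFinP; apply: measurable_funM => //; exact: measurable_indic.
transitivity (\int[nu]_(t in D)
   (\sum_(r \in range (h k)) (r * \1_(h k @^-1` [set r]) t)%:E)).
  by apply: eq_integral => t _; rewrite fsumEFin// -fimfunE.
rewrite ge0_integral_fsum//; last by move=> r t _; exact: nnfun_muleindic_ge0.
transitivity (\int[mu]_(t in D)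
   (\sum_(r \in range (h k))
     ((r * \1_(h k @^-1` [set r]) t)%:E * (g t)%:E))); last first.
  apply: eq_integral => t _; rewrite -ge0_mule_fsuml; last first.
    by move=> r; exact: nnfun_muleindic_ge0.
  by rewrite fsumEFin// -fimfunE.
rewrite ge0_integral_fsum//; last 2 first.
- move=> r; apply: emeasurable_funM => //.
  exact/measurable_EFinP/measurable_funTS.
- move=> r t _; apply: mule_ge0; last by rewrite lee_fin.
  exact: nnfun_muleindic_ge0.
(* One level set at a time; writing [r] as a value of [h k] shows that it is nonnegative. *)
apply: eq_fsbigr => r /set_mem[t0 _ <-{r}].
set A := h k @^-1` _; have mA : measurable A.
  by rewrite /A -[X in measurable X]setTI; exact: measurable_funP.
under eq_integral do rewrite EFinM.
rewrite ge0_integralZl//=; last 2 first.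
- by apply/measurable_EFinP; exact: measurable_indic.
- by rewrite lee_fin.
rewrite integral_indic// (nuE (measurableI _ _ mA mD)).
under [RHS]eq_integral do rewrite EFinM -muleA.
rewrite ge0_integralZl//=; last 3 first.
- apply: emeasurable_funM; apply/measurable_EFinP.
    exact: measurable_indic.
  exact: measurable_funTS.
- by move=> t _; rewrite -EFinM lee_fin mulr_ge0.
- by rewrite lee_fin.
congr (_ * _); rewrite -setIA setIid integral_mkcondl.
apply: eq_integral => t _; rewrite patchE indicE.
by case: ifPn; rewrite ?mul1e ?mul0e.
Qed.

End density.

(** * Dirichlet's integral *)

Section dirichlet.
Context {R : realType}.
Local Notation mu := (@lebesgue_measure R).

Lemma ge0_integral_lebesgue_tupleS n (f : n.+1.-tuple R -> \bar R) :
  measurable_fun setT f -> (forall t, 0 <= f t)%E ->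
  (\int[lebesgue_tuple n.+1]_t f t =
   \int[mu]_s \int[lebesgue_tuple n]_t f (cons_pair (s, t)))%E.
Proof.
move=> mf f0.
have mc := @measurable_cons_pair R n.
rewrite [LHS](@ge0_integral_pushforward _ _ _ _ _ _ mc (mu \x lebesgue_tuple n)%E)//.
rewrite preimage_setT fubini_tonelli1//.
- exact: measurableT_comp.
- by move=> p; exact: f0.
Qed.

Lemma measurable_dirichlet n (x : 'I_n -> R) r :
  measurable_fun [set: n.-tuple R] (fun t =>
    (\prod_i powk (x i) (tnth t i)) * powk 1 (r - \sum_i tnth t i)).
Proof.
apply: measurable_funM.
  apply: measurable_prod => i _.
  exact: (measurableT_comp (measurable_powk (x i)) (measurable_tnth i)).
apply: (measurableT_comp (measurable_powk 1)).
apply: measurable_funB => //.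
by apply: measurable_sum => i; exact: measurable_tnth.
Qed.

(** The factor [powk 1] is the indicator of a total at most [r]. A variable [r] drives the
    induction: fixing the first coordinate [s] leaves the same integral with [r - s], and the
    integral over [s] is then a convolution of power kernels. *)
Lemma dirichlet_integral n (x : 'I_n -> R) r : (forall i, 0 < x i) ->
  (\int[lebesgue_tuple n]_t
     ((\prod_i powk (x i) (tnth t i)) * powk 1 (r - \sum_i tnth t i))%:E =
   (\prod_i Gamma (x i) / Gamma (1 + \sum_i x i) * powk (1 + \sum_i x i) r)%:E)%E.
Proof.
elim: n x r => [|n IHn] x r x0.
  rewrite integral_dirac//; last by apply/measurable_EFinP; exact: measurable_dirichlet.
  rewrite diracT mul1e !big_ord0 subr0 addr0 mul1r.
  have -> : Gamma 1 = 1 :> R by apply: EFin_inj; rewrite EFin_Gamma// GammaE1.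
  by rewrite divr1 mul1r.
have F0 m (y : 'I_m -> R) q (t : m.-tuple R) :
   (0 <= ((\prod_i powk (y i) (tnth t i)) * powk 1 (q - \sum_i tnth t i))%:E)%E.
  by rewrite lee_fin mulr_ge0 ?powk_ge0// prodr_ge0// => i _; exact: powk_ge0.
rewrite ge0_integral_lebesgue_tupleS//; last first.
  by apply/measurable_EFinP; exact: measurable_dirichlet.
pose y (i : 'I_n) := x (lift ord0 i).
have y0 i : 0 < y i by exact: x0.
have Y0 : 0 <= \sum_i y i by apply: sumr_ge0 => i _; exact: ltW.
transitivity (\int[mu]_s ((\prod_i Gamma (y i) / Gamma (1 + \sum_i y i))%:E *
    (powk (x ord0) s * powk (1 + \sum_i y i) (r - s))%:E))%E.
  apply: eq_integral => s _.
  under eq_integral => t _.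
    rewrite big_ord_recl [X in r - X]big_ord_recl.
    rewrite tnth0; under eq_bigr do rewrite tnthS.
    under [X in r - (_ + X)]eq_bigr do rewrite tnthS.
    rewrite opprD addrA -mulrA EFinM.
    over.
  rewrite /= ge0_integralZl//=; last 3 first.
  - by apply/measurable_EFinP; exact: measurable_dirichlet.
  - by move=> t _; exact: F0.
  - by rewrite lee_fin powk_ge0.
  by rewrite IHn// -!EFinM; congr EFin; rewrite mulrCA.
have C0 : 0 <= \prod_i Gamma (y i) / Gamma (1 + \sum_i y i).
  by rewrite divr_ge0 ?Gamma_ge0// prodr_ge0// => i _; exact: Gamma_ge0.
rewrite ge0_integralZl//; last 2 first.
- by apply/measurable_EFinP; exact: measurable_powk_conv.
- by move=> s _; rewrite lee_fin mulr_ge0 ?powk_ge0.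
(* The second exponent, [1 + \sum_i y i], is at least 1, as both lemmas require. *)
rewrite powk_conv ?lerDl// betaE_Gamma ?lerDl// -!EFinM; congr EFin.
rewrite !big_ord_recl -/(y _) (addrCA 1) mulrA; congr (_ * _).
have : Gamma (1 + \sum_i y i) != 0.
  by rewrite gt_eqF// Gamma_gt0// ltr_wpDr.
move=> g; rewrite (mulrC (Gamma (x ord0)) (Gamma _)) !mulrA divfK//.
by rewrite (mulrC (Gamma _)).
Qed.

Lemma dirichlet_simplex n (x : 'I_n -> R) : (forall i, 0 < x i) ->
  (\int[lebesgue_tuple n]_(t in simplex n) (\prod_i tnth t i `^ (x i - 1))%:E =
   (\prod_i Gamma (x i) / Gamma (1 + \sum_i x i))%:E)%E.
Proof.
move=> x0; have := dirichlet_integral 1 x0.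
rewrite {3}/powk ler01 powR1 mulr1 => <-.
rewrite integral_mkcond; apply: eq_integral => t _; rewrite patchE.
case: ifPn => [/set_mem[t0 t1]|/negP nt].
  rewrite powk1 subr_ge0 t1 mulr1; congr EFin.
  by apply: eq_bigr => i _; rewrite /powk t0.
congr EFin; apply/esym; rewrite powk1 subr_ge0.
(* Outside the simplex either the total exceeds 1 or some coordinate is negative; in both cases a
   factor vanishes. *)
have [t1|_] := leP (\sum_i tnth t i) 1; last by rewrite mulr0.
have [/forallP t0|] := boolP [forall i, 0 <= tnth t i].
  by exfalso; apply: nt; exact: mem_set.
rewrite negb_forall => /existsP[i ti].
by rewrite (bigD1 i)//= /powk (negbTE ti) !mul0r.
Qed.

End dirichlet.

(** * Convex functions on a simplex *)

Section convex_combination.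
Context {R : realType}.
Implicit Types V : lmodType R.

(** Real scalars with explicit bounds replace the interval-typed coefficients of [convex_set] and
    [convex_function], so that coefficients can be computed freely. *)
Definition segment_closed V (D : set V) := forall x y (s : R),
  D x -> D y -> 0 <= s <= 1 -> D (s *: x + (1 - s) *: y).

Definition convex_on V (D : set V) (f : V -> R) := forall x y (s : R),
  D x -> D y -> 0 <= s <= 1 ->
  f (s *: x + (1 - s) *: y) <= s * f x + (1 - s) * f y.

Lemma convex_set_segment_closed V (D : set V) :
  convex_set D -> segment_closed D.
Proof.
move=> cD x y s /mem_set Dx /mem_set Dy /andP[s0 s1]; apply/set_mem.
by have := cD x y (Itv01 s0 s1) Dx Dy.
Qed.

Lemma convex_function_convex_on V (D : set V) (f : V -> R) :
  convex_function D f -> convex_on D f.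
Proof.
move=> cf x y s /mem_set Dx /mem_set Dy /andP[s0 s1].
by have := cf (Itv01 s0 s1) x y Dx Dy.
Qed.

Lemma concave_function_convex_on V (D : set V) (f : V -> R) :
  concave_function D f -> convex_on D (fun x => - f x).
Proof.
move=> cf x y s /mem_set Dx /mem_set Dy /andP[s0 s1].
rewrite !mulrN -opprD lerN2.
by have := cf (Itv01 s0 s1) x y Dx Dy.
Qed.

(** Induction on the number of points, the weights after the first being rescaled by [1 - w ord0].
    Membership in [D] is carried along because convexity is applied to the first point and the mean
    of the others. *)
Lemma jensen_sum V (D : set V) (f : V -> R) m (w : 'I_m -> R) (a : 'I_m -> V) :
  segment_closed D -> convex_on D f ->
  (forall i, 0 <= w i) -> \sum_i w i = 1 -> (forall i, D (a i)) ->
  D (\sum_i w i *: a i) /\ f (\sum_i w i *: a i) <= \sum_i w i * f (a i).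
Proof.
move=> cD cf; elim: m w a => [|m IHm] w a w0 w1 Da.
  by move: w1; rewrite big_ord0 => /eqP; rewrite eq_sym oner_eq0.
move: w1; rewrite !big_ord_recl => w1.
have W0 : 0 <= \sum_(i < m) w (lift ord0 i) by exact: sumr_ge0.
(* No rescaling is possible when the remaining weights vanish; the mean is then the first point. *)
have [W|W] := eqVneq (\sum_(i < m) w (lift ord0 i)) 0.
  have w0E i : w (lift ord0 i) = 0.
    by move/eqP: W; rewrite psumr_eq0// => /allP/(_ i (mem_index_enum _))/eqP.
  have {}w1 : w ord0 = 1 by rewrite -w1 W addr0.
  rewrite big1; last by move=> i _; rewrite w0E scale0r.
  rewrite big1; last by move=> i _; rewrite w0E mul0r.
  by rewrite !addr0 w1 scale1r mul1r.
have WE : \sum_(i < m) w (lift ord0 i) = 1 - w ord0 by rewrite -w1 addrC addKr.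
rewrite WE in W W0; pose v i := w (lift ord0 i) / (1 - w ord0).
have [] := IHm v (fun i => a (lift ord0 i)).
- by move=> i; rewrite /v divr_ge0.
- by rewrite -mulr_suml WE divff.
- by [].
have wE i : w (lift ord0 i) = (1 - w ord0) * v i by rewrite /v mulrC divfK.
have -> : \sum_(i < m) w (lift ord0 i) *: a (lift ord0 i) =
    (1 - w ord0) *: \sum_i v i *: a (lift ord0 i).
  by rewrite scaler_sumr; apply: eq_bigr => i _; rewrite scalerA wE.
have -> : \sum_(i < m) w (lift ord0 i) * f (a (lift ord0 i)) =
    (1 - w ord0) * \sum_i v i * f (a (lift ord0 i)).
  by rewrite mulr_sumr; apply: eq_bigr => i _; rewrite mulrA wE.
move=> Dv fv; have w01 : 0 <= w ord0 <= 1 by rewrite w0/= -subr_ge0.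
split; first exact: cD.
by apply: le_trans (cf _ _ _ (Da ord0) Dv w01) _; rewrite lerD2l ler_wpM2l.
Qed.

(* One-dimensional extension step of Hahn-Banach: [al] is any number between the
   slopes [phi x / u x] over [u x < 0] and those over [u x > 0]. *)
Lemma support_step V (D : set V) (phi u : V -> R) :
  segment_closed D -> convex_on D phi ->
  (forall x y s, u (s *: x + (1 - s) *: y) = s * u x + (1 - s) * u y) ->
  (forall x, D x -> u x = 0 -> 0 <= phi x) ->
  (exists2 x, D x & u x < 0) -> (exists2 x, D x & 0 < u x) ->
  exists al, forall x, D x -> al * u x <= phi x.
Proof.
move=> cD cphi uE phi0 [x1 Dx1 ux1] [x2 Dx2 ux2].
pose B := [set r | exists2 x, D x /\ u x < 0 & r = phi x / u x].
have slope x y : D x -> u x < 0 -> D y -> 0 < u y -> phi x / u x <= phi y / u y.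
  move=> Dx ux Dy uy; have d0 : 0 < u y - u x by rewrite subr_gt0 (lt_trans ux).
  (* The mixing weight at which [u] vanishes, so that [phi] is nonnegative there. *)
  pose s := u y / (u y - u x).
  have sE : 1 - s = - u x / (u y - u x).
    by rewrite /s -[X in X - _](divff (lt0r_neq0 d0)) -mulrBl addrAC subrr sub0r.
  have s01 : 0 <= s <= 1.
    rewrite /s divr_ge0 ?(ltW uy) ?(ltW d0)//= ler_pdivrMr// mul1r lerDl.
    by rewrite oppr_ge0 ltW.
  have : 0 <= phi (s *: x + (1 - s) *: y).
    apply: phi0; first exact: cD.
    by rewrite uE sE /s; field; exact: lt0r_neq0.
  move/le_trans/(_ (cphi _ _ _ Dx Dy s01)); rewrite sE /s.
  rewrite [u y / _ * _]mulrAC [- u x / _ * _]mulrAC -mulrDl pmulr_lge0 ?invr_gt0//.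
  rewrite ler_pdivlMr// mulrAC ler_ndivrMr// => h.
  by rewrite -subr_ge0 (le_trans h)// mulNr [u y * _]mulrC [u x * _]mulrC.
have B0 : B !=set0 by exists (phi x1 / u x1); exists x1.
have ubB y : D y -> 0 < u y -> ubound B (phi y / u y).
  by move=> Dy uy _ [x [Dx ux] ->]; exact: slope.
exists (sup B) => x Dx; have [ux|ux|ux] := ltgtP (u x) 0.
- rewrite -ler_ndivrMr//; apply: ub_le_sup; last by exists x.
  by exists (phi x2 / u x2); exact: ubB.
- by rewrite -ler_pdivlMr//; apply: ge_sup => //; exact: ubB.
- by rewrite ux mulr0 phi0.
Qed.

End convex_combination.

(** * Supporting linear forms on the simplex of weights *)

Section weights.
Context {R : realType} (n : nat).
Implicit Types w v : 'rV[R]_n.+1.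

(** Keeping all [n.+1] coordinates, as a row vector, makes every affine function on the simplex a
    linear form. *)
Definition weights : set 'rV[R]_n.+1 :=
  [set w | (forall i, 0 <= w 0 i) /\ \sum_i w 0 i = 1].

Lemma weights_segment_closed : segment_closed weights.
Proof.
move=> x y s [x0 x1] [y0 y1] /andP[s0 s1]; split.
  by move=> i; rewrite !mxE addr_ge0// mulr_ge0// subr_ge0.
under eq_bigr do rewrite !mxE.
by rewrite big_split/= -!mulr_sumr x1 y1 !mulr1 subrKC.
Qed.

(* Supporting hyperplane at an interior point of the simplex, in homogeneous
   form, built one coordinate at a time. *)
Lemma weights_support (G : 'rV[R]_n.+1 -> R) v : convex_on weights G ->
  (forall i, 0 < v 0 i) -> \sum_i v 0 i = 1 ->
  exists c : 'I_n.+1 -> R, \sum_i c i * v 0 i = G v /\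
    forall w, weights w -> \sum_i c i * w 0 i <= G w.
Proof.
move=> cG v0 v1.
(* Coordinates [k] to [n - 1] are frozen at those of [v]. The last one is never frozen but is
   determined by the sum: [D 0] contains only [v], and [D n] is the whole simplex. *)
pose D k := [set w | weights w /\
  forall j : 'I_n.+1, (k <= j < n)%N -> w 0 j = v 0 j].
have Wv : weights v by split => // i; exact: ltW.
suff /(_ n (leqnn n))[c hc] : forall k, (k <= n)%N -> exists c : 'I_n.+1 -> R,
    forall w, D k w -> \sum_i c i * (w 0 i - v 0 i) <= G w - G v.
  (* Weights sum to 1, so a constant term is absorbed by adding it to every coefficient. *)
  exists (fun i => c i + (G v - \sum_i c i * v 0 i)).
  have E w : weights w -> \sum_i (c i + (G v - \sum_i c i * v 0 i)) * w 0 i =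
      G v + \sum_i c i * (w 0 i - v 0 i).
    move=> [_ w1]; under eq_bigr do rewrite mulrDl.
    rewrite big_split/= -mulr_sumr w1 mulr1.
    under [in RHS]eq_bigr do rewrite mulrBr.
    by rewrite sumrB addrCA.
  split; first by rewrite E// big1 ?addr0// => i _; rewrite subrr mulr0.
  move=> w Ww; rewrite E// addrC -lerBrDr hc//; split => // j.
  by case: ltngtP.
elim => [_|k IHk kn].
  exists (fun=> 0) => w [[_ w1] wv]; rewrite big1; last by move=> i _; rewrite mul0r.
  suff -> : w = v by rewrite subrr.
  have wvj (j : 'I_n.+1) : j != ord_max -> w 0 j = v 0 j.
    move=> jn; apply: wv => //=; rewrite ltn_neqAle -ltnS ltn_ord andbT.
    by apply: contra jn => /eqP jn; apply/eqP/val_inj.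
  apply/rowP => j; have [->|] := eqVneq j ord_max; last exact: wvj.
  move: w1; rewrite -v1 [in LHS](bigD1 ord_max)//= [in RHS](bigD1 ord_max)//=.
  by rewrite (eq_bigr _ wvj) => /addIr.
have [c hc] := IHk (ltnW kn).
pose K : 'I_n.+1 := inord k.
have KE : K = k :> nat by rewrite inordK// ltnS ltnW.
have Kn : K != ord_max by rewrite -val_eqE/= KE ltn_eqF.
pose phi w := G w - G v - \sum_i c i * (w 0 i - v 0 i).
pose u w := w 0 K - v 0 K.
(* Mass [s] may be moved from the last coordinate to [K] within this range. Its ends are nonzero,
   [v] being interior, and give points on both sides of [u = 0]. *)
have DP s : - v 0 K <= s <= v 0 ord_max ->
    D k.+1 (v + s *: (delta_mx 0 K - delta_mx 0 ord_max)).
  move=> /andP[s1 s2]; split; first split.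
  - move=> i; rewrite !mxE/=.
    have [->|iK] := eqVneq i K.
      by rewrite (negbTE Kn) subr0 mulr1 addrC -lerBlDr sub0r.
    have [->|ii] := eqVneq i ord_max; first by rewrite sub0r mulrN1 subr_ge0.
    by rewrite subrr mulr0 addr0 ltW.
  - under eq_bigr do rewrite !mxE/=.
    rewrite big_split/= v1 -mulr_sumr sumrB.
    rewrite (bigD1 K)//= eqxx big1; last by move=> i /negbTE ->.
    rewrite (bigD1 ord_max)//= eqxx big1; last by move=> i /negbTE ->.
    by rewrite subrr mulr0 addr0.
  - move=> j /andP[kj jn]; rewrite !mxE/=.
    have -> : (j == K) = false by apply/negbTE; rewrite -val_eqE/= KE gtn_eqF.
    have -> : (j == ord_max) = false by apply/negbTE; rewrite -val_eqE/= ltn_eqF.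
    by rewrite subrr mulr0 addr0.
have uP s : u (v + s *: (delta_mx 0 K - delta_mx 0 ord_max)) = s.
  by rewrite /u !mxE/= eqxx (negbTE Kn) subr0 mulr1 addrAC subrr add0r.
have [||||||al hal] := @support_step _ _ (D k.+1) phi u.
- move=> x y s [Wx xv] [Wy yv] s01; split; first exact: weights_segment_closed.
  by move=> j jkn; rewrite !mxE xv// yv//; ring.
- move=> x y s [Wx _] [Wy _] s01; rewrite /phi.
  have -> : \sum_i c i * ((s *: x + (1 - s) *: y) 0 i - v 0 i) =
      s * (\sum_i c i * (x 0 i - v 0 i)) + (1 - s) * (\sum_i c i * (y 0 i - v 0 i)).
    rewrite !mulr_sumr -big_split/=; apply: eq_bigr => i _; rewrite !mxE; ring.
  have := cG _ _ _ Wx Wy s01; lra.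
- by move=> x y s; rewrite /u !mxE; ring.
- move=> x [Wx xv] /eqP; rewrite subr_eq0 => /eqP xK.
  rewrite subr_ge0; apply: hc; split => // j /andP[kj jn].
  have [<-|jK] := eqVneq K j; first exact: xK.
  apply: xv; rewrite jn andbT ltn_neqAle kj andbT.
  by apply: contra jK => /eqP kjE; apply/eqP/val_inj; rewrite /= KE.
- exists (v + (- v 0 K) *: (delta_mx 0 K - delta_mx 0 ord_max)).
    by apply: DP; rewrite lexx/= (@le_trans _ _ 0)// ?oppr_le0 ltW.
  by rewrite uP oppr_lt0.
- exists (v + (v 0 ord_max) *: (delta_mx 0 K - delta_mx 0 ord_max)).
    by apply: DP; rewrite lexx andbT (@le_trans _ _ 0)// ?oppr_le0 ltW.
  by rewrite uP.
exists (fun i => c i + al * (i == K)%:R) => w Dw.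
under eq_bigr do rewrite mulrDl.
rewrite big_split/= [X in _ + X](bigD1 K)//= eqxx mulr1.
rewrite [X in _ + (_ + X)]big1 ?addr0; last first.
  by move=> i /negbTE ->; rewrite mulr0 mul0r.
by rewrite addrC -lerBrDr; exact: hal.
Qed.

End weights.

(** * Barycentric coordinates and measurability of convex functions *)

Section barycentric.
Context {R : realType} (n : nat).
Implicit Types t : n.-tuple R.

Lemma bary_lift t j : bary t (lift ord_max j) = tnth t j.
Proof. by rewrite /bary liftK. Qed.

Lemma bary_max t : bary t ord_max = 1 - \sum_j tnth t j.
Proof. by rewrite /bary unlift_none. Qed.

Lemma sum_bary t : \sum_i bary t i = 1.
Proof.
rewrite (bigD1_ord ord_max)//= bary_max.
by under [X in _ + X]eq_bigr do rewrite bary_lift; rewrite subrK.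
Qed.

Definition bary_row t : 'rV[R]_n.+1 := \row_i bary t i.

Lemma bary_ge0 t i : simplex n t -> 0 <= bary t i.
Proof.
move=> [t0 t1]; case: (unliftP ord_max i) => [j|] ->; first by rewrite bary_lift.
by rewrite bary_max subr_ge0.
Qed.

Lemma bary_gt0 t i : int_simplex n t -> 0 < bary t i.
Proof.
move=> [t0 t1]; case: (unliftP ord_max i) => [j|] ->; first by rewrite bary_lift.
by rewrite bary_max subr_gt0.
Qed.

Lemma weights_bary t : simplex n t -> weights (bary_row t).
Proof.
move=> St; split; first by move=> i; rewrite mxE bary_ge0.
by rewrite -[RHS](sum_bary t); apply: eq_bigr => i _; rewrite mxE.
Qed.

Lemma measurable_bary i : measurable_fun [set: n.-tuple R] (fun t => bary t i).
Proof.
case: (unliftP ord_max i) => [j|] ->.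
  by under eq_fun do rewrite bary_lift; exact: measurable_tnth.
under eq_fun do rewrite bary_max.
by apply: measurable_funB => //; apply: measurable_sum => j; exact: measurable_tnth.
Qed.

(* A convex function on a simplex is upper semicontinuous up to the boundary: if
   [t >= (1 - e) t0] in barycentric coordinates then [t] is the mixture of [t0]
   and some point of the simplex with weights [1 - e] and [e]. *)
Lemma measurable_convex_bary (G : 'rV[R]_n.+1 -> R) B :
  convex_on (@weights R n) G -> (forall w, weights w -> G w <= B) ->
  measurable_fun (simplex n) (fun t => G (bary_row t)).
Proof.
move=> cG GB mS; apply: (measurability _ (RGenInftyO.measurableE R)) => //.
move=> _ [_ [c ->] <-].
set S := _ `&` _.
(* A strict sublevel set will be the union of the sets [U q], given by rational lower bounds [q],
   that it contains; there are countably many. *)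
pose U (q : {ffun 'I_n.+1 -> rat}) : set (n.-tuple R) :=
  simplex n `&` \bigcap_(i in [set: 'I_n.+1]) [set t | ratr (q i) <= bary t i].
have mU q : measurable (U q).
  apply: measurableI => //; apply: fin_bigcap_measurable => // i _.
  rewrite (_ : mkset _ =
      (fun t => bary t i) @^-1` `[ratr (q i), +oo[%classic); last first.
    by apply/seteqP; split => t /=; rewrite in_itv/= andbT.
  rewrite -[X in measurable X]setTI; apply: measurable_bary => //.
pose F q : set (n.-tuple R) := if `[< U q `<=` S >] then U q else set0.
rewrite (_ : S = \bigcup_q F q).
  apply: countable_bigcupT_measurable => [|q]; first exact: countableP.
  by rewrite /F; case: asboolP.
apply/seteqP; split => [t0 [St0]|t [q _]]; last first.
  by rewrite /F; case: asboolP => // US /US.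
rewrite /= in_itv/= => Gt0.
set x0 := bary_row t0 in Gt0.
have Wx0 : weights x0 by exact: weights_bary.
pose d := c - G x0; have d0 : 0 < d by rewrite subr_gt0.
pose K := `|B - G x0|; have K0 : 0 <= K by exact: normr_ge0.
(* Chosen so that [e * K < d]: a mixture giving weight [e] to any point of the simplex and [1 - e]
   to [x0] keeps [G] below [c]. *)
pose e := d / (d + K).
have dK0 : 0 < d + K by rewrite ltr_wpDr.
have e0 : 0 < e by rewrite divr_gt0.
have e1 : e <= 1 by rewrite ler_pdivrMr// mul1r lerDl.
have eB : (1 - e) * G x0 + e * B < c.
  have -> : (1 - e) * G x0 + e * B = G x0 + e * (B - G x0) by ring.
  rewrite -ltrBrDl -/d (@le_lt_trans _ _ (e * K))//.
    by rewrite ler_wpM2l ?(ltW e0)// ler_norm.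
  by rewrite /e mulrAC ltr_pdivrMr// ltr_pM2l// ltrDr.
(* Where a coordinate of [t0] vanishes, [q = 0] is the only choice; hence the non-strict bounds in
   [U]. *)
have /choice[q hq] : forall i, exists q : rat,
    (1 - e) * bary t0 i <= ratr q <= bary t0 i.
  move=> i; have := bary_ge0 i St0; rewrite le_eqVlt => /predU1P[<-|b0].
    by exists 0; rewrite rmorph0 mulr0 lexx.
  have [|q] := @rat_in_itvoo R ((1 - e) * bary t0 i) (bary t0 i).
    by rewrite gtr_pMl// ltrBlDr ltrDl.
  by rewrite in_itv/= => /andP[/ltW q1 /ltW q2]; exists q; rewrite q1.
exists [ffun i => q i] => //.
rewrite /F; case: asboolP => [_|[]].
  by split => // i _ /=; rewrite ffunE; have /andP[] := hq i.
move=> t [St Ut]; split => //=; rewrite in_itv/=.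
(* The solution of [bary_row t = (1 - e) *: x0 + e *: s]; the lower bounds on [t] make its
   coordinates nonnegative. *)
pose s : 'rV[R]_n.+1 := e^-1 *: (bary_row t - (1 - e) *: x0).
have Ws : weights s.
  split.
    move=> i; rewrite !mxE mulr_ge0 ?invr_ge0 ?(ltW e0)// subr_ge0.
    by have := Ut i Logic.I; rewrite /= ffunE; apply: le_trans; have /andP[] := hq i.
  under eq_bigr do rewrite !mxE.
  rewrite -mulr_sumr sumrB -mulr_sumr !sum_bary mulr1 opprB addrCA subrr addr0.
  by rewrite mulVf// gt_eqF.
have -> : bary_row t = (1 - e) *: x0 + (1 - (1 - e)) *: s.
  by rewrite opprB addrCA subrr addr0 scalerA mulfV ?gt_eqF// scale1r subrKC.
apply: le_lt_trans eB; apply: le_trans (cG _ _ _ Wx0 Ws _) _.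
  by rewrite subr_ge0 e1/= lerBlDr lerDl ltW.
by rewrite opprB addrCA subrr addr0 lerD2l ler_wpM2l ?(ltW e0)// GB.
Qed.

End barycentric.

(** * Mass and mean of mu_lambda *)

Section mu_lambda_moments.
Context {R : realType} (n : nat) (l : n.-tuple R).
Hypotheses (n0 : (0 < n)%N) (hl : int_simplex n l).
Local Notation p := (fun i => (alpha l i)^-1).
Let L := bary l ord_max.

Let L0 : 0 < L. Proof. exact: bary_gt0. Qed.

Let p_gt0 i : 0 < p i.
Proof. by rewrite invr_gt0 divr_gt0//; have [] := hl. Qed.

Let pE i : p i = tnth l i / L.
Proof. by rewrite /alpha invf_div. Qed.

Let sum_p_gt0 : 0 < \sum_i p i.
Proof.
rewrite (bigD1 (Ordinal n0))//= ltr_wpDr//.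
by apply: sumr_ge0 => i _; exact: ltW.
Qed.

Let sum_pD1 : 1 + \sum_i p i = L^-1.
Proof.
under eq_bigr do rewrite pE.
rewrite -mulr_suml -[X in X + _](divff (lt0r_neq0 L0)) -mulrDl.
by rewrite /L bary_max subrK mul1r.
Qed.

Let c := (\sum_i p i) / multi_beta p.

Let c_ge0 : 0 <= c.
Proof. by rewrite divr_ge0 ?multi_beta_ge0// ltW. Qed.

(** [multi_beta] involves Gamma at the sum of the [p i], Dirichlet's integral Gamma at that sum plus
    one; the numerator of [c] is the ratio of the two. *)
Let cE : c * (\prod_i Gamma (p i) / Gamma (1 + \sum_i p i)) = 1.
Proof.
have P0 : \prod_i Gamma (p i) != 0.
  by apply/prodf_neq0 => i _; rewrite gt_eqF// Gamma_gt0.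
have S0 := lt0r_neq0 sum_p_gt0; have G0 := lt0r_neq0 (Gamma_gt0 sum_p_gt0).
rewrite /c /multi_beta addrC GammaD1//; field.
by rewrite S0 G0 P0.
Qed.

Lemma mu_lambda_simplex : mu_lambda hl (simplex n) = 1%E.
Proof.
rewrite /mu_lambda setIid /mu_density.
under eq_integral do rewrite EFinM.
rewrite ge0_integralZl//=; last 3 first.
- exact: measurable_simplex.
- apply/measurable_EFinP/measurable_funTS; apply: measurable_prod => i _.
  apply: (@measurableT_comp _ _ _ _ _ _ (@powR R ^~ _)); first exact: measurable_powR.
  exact: measurable_tnth.
- by move=> t _; rewrite lee_fin prodr_ge0// => i _; exact: powR_ge0.
by rewrite dirichlet_simplex// -EFinM cE.
Qed.

Let integral_mu_lambda1 :
  (\int[mu_lambda hl]_(t in simplex n) cst 1%:E t = 1)%E.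
Proof.
rewrite integral_cst ?mul1e; first exact: mu_lambda_simplex.
exact: measurable_simplex.
Qed.

Let integrable_mu_lambda1 : (mu_lambda hl).-integrable (simplex n) (cst 1%:E).
Proof.
apply/integrableP; split => //.
under eq_integral do rewrite /= normr1.
by rewrite integral_mu_lambda1 ltry.
Qed.

(** A factor [tnth t i] raises the parameter [p i] by one. The two shifts in Gamma then leave [p i]
    divided by the total [1 + \sum_j p j], which is [L^-1], and [p i * L] is [tnth l i]. *)
Lemma integral_mu_lambda_tnth i :
  (\int[mu_lambda hl]_(t in simplex n) (tnth t i)%:E = (tnth l i)%:E)%E.
Proof.
have mS := @measurable_simplex R n.
rewrite (@ge0_integral_density _ _ _ (lebesgue_tuple n) _ _ (mu_density l))//;
  last 4 first.
- exact: measurable_mu_density.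
- by move=> t; exact: mu_density_ge0.
- by apply/measurable_EFinP/measurable_funTS; exact: measurable_tnth.
- by move=> t [t0 _]; rewrite lee_fin.
pose x j := p j + (j == i)%:R.
transitivity (\int[lebesgue_tuple n]_(t in simplex n)
    (c%:E * (\prod_j tnth t j `^ (x j - 1))%:E))%E.
  apply: eq_integral => t /set_mem[t0 _].
  rewrite /mu_density -/c -!EFinM mulrCA; congr (c * _)%:E.
  rewrite [in LHS](bigD1 i)//= [in RHS](bigD1 i)//= /x eqxx mulrA; congr (_ * _).
    (* Valid at a zero coordinate too, both sides being 0 there because [p i > 0]. *)
    by rewrite mulr_powRB1// addrK.
  by apply: eq_bigr => j /negbTE ->; rewrite addr0.
have x0 j : 0 < x j by rewrite ltr_wpDr.
have xi : x i = p i + 1 by rewrite /x eqxx.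
have xGj j : j != i -> Gamma (x j) = Gamma (p j).
  by move=> /negbTE ji; rewrite /x ji addr0.
rewrite ge0_integralZl//=; last 2 first.
- apply/measurable_EFinP/measurable_funTS; apply: measurable_prod => j _.
  apply: (@measurableT_comp _ _ _ _ _ _ (@powR R ^~ _)); first exact: measurable_powR.
  exact: measurable_tnth.
- by move=> t _; rewrite lee_fin prodr_ge0// => j _; exact: powR_ge0.
rewrite dirichlet_simplex// -EFinM; congr EFin.
have -> : \prod_j Gamma (x j) = p i * \prod_j Gamma (p j).
  rewrite [LHS](bigD1 i isT)/= [in RHS](bigD1 i isT)/= xi (GammaD1 (p_gt0 i)) -mulrA.
  by rewrite (eq_bigr _ xGj).
have -> : \sum_j x j = \sum_j p j + 1.
  rewrite big_split/=; congr (_ + _); rewrite (bigD1 i)//= eqxx big1 ?addr0//.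
  by move=> j /negbTE ->.
have S1 : 0 < 1 + \sum_j p j by rewrite addr_gt0.
rewrite addrA GammaD1// -mulf_div mulrCA cE mulr1.
by rewrite sum_pD1 invrK pE divfK// gt_eqF.
Qed.

Lemma integrable_mu_lambda_bary i :
  (mu_lambda hl).-integrable (simplex n) (fun t => (bary t i)%:E).
Proof.
have mS := @measurable_simplex R n.
apply: (@le_integrable _ _ _ _ _ mS _ (cst 1%E)).
- by apply/measurable_EFinP/measurable_funTS; exact: measurable_bary.
- move=> t St /=; rewrite lee_fin normr1 ger0_norm ?bary_ge0//.
  rewrite -(sum_bary t) (bigD1 i)//= lerDl.
  by apply: sumr_ge0 => j _; exact: bary_ge0.
- exact: integrable_mu_lambda1.
Qed.

Lemma integral_mu_lambda_bary i :
  (\int[mu_lambda hl]_(t in simplex n) (bary t i)%:E = (bary l i)%:E)%E.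
Proof.
have mS := @measurable_simplex R n.
have int_tnth j : (mu_lambda hl).-integrable (simplex n) (fun t => (tnth t j)%:E).
  by under eq_fun do rewrite -bary_lift; exact: integrable_mu_lambda_bary.
case: (unliftP ord_max i) => [j|] ->.
  under eq_integral do rewrite bary_lift.
  by rewrite integral_mu_lambda_tnth bary_lift.
under eq_integral do rewrite bary_max EFinB -sumEFin.
rewrite integralB//; last first.
  exact: integrable_sum.
rewrite integral_mu_lambda1 integral_sum//.
under eq_bigr do rewrite integral_mu_lambda_tnth.
by rewrite sumEFin bary_max.
Qed.

(** The mean in the form in which it is used, for a linear minorant and a linear majorant of the
    integrand. *)
Lemma mu_lambda_linear (k : 'I_n.+1 -> R) :
  (mu_lambda hl).-integrable (simplex n) (fun t => (\sum_i k i * bary t i)%:E) /\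
  (\int[mu_lambda hl]_(t in simplex n) (\sum_i k i * bary t i)%:E =
   (\sum_i k i * bary l i)%:E)%E.
Proof.
have mS := @measurable_simplex R n.
have intk i : (mu_lambda hl).-integrable (simplex n)
    (fun t => (k i)%:E * (bary t i)%:E)%E.
  by apply: integrableZl => //; exact: integrable_mu_lambda_bary.
under eq_fun do rewrite -sumEFin.
under eq_fun do under eq_bigr do rewrite EFinM.
split; first exact: integrable_sum.
rewrite integral_sum// -sumEFin; apply: eq_bigr => i _.
rewrite integralZl//; last exact: integrable_mu_lambda_bary.
by rewrite integral_mu_lambda_bary.
Qed.

End mu_lambda_moments.

(** * The Hermite-Hadamard inequalities *)

(** Formulated with [convex_on], so that it applies directly to [- f] in the concave case. *)
Lemma mu_lambda_hermite_hadamard (R : realType) (n : nat) (n0 : (0 < n)%N)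
    (l : n.-tuple R) (hl : int_simplex n l) (V : lmodType R) (C : set V)
    (f : V -> R) (a : 'I_n.+1 -> V) :
  segment_closed C -> convex_on C f -> (forall i, C (a i)) ->
  [/\ (mu_lambda hl).-integrable (simplex n)
        (fun t => (f (\sum_i bary t i *: a i))%:E),
      ((f (\sum_i bary l i *: a i))%:E <=
        \int[mu_lambda hl]_(t in simplex n) (f (\sum_i bary t i *: a i))%:E)%E &
      (\int[mu_lambda hl]_(t in simplex n) (f (\sum_i bary t i *: a i))%:E <=
        (\sum_i bary l i * f (a i))%:E)%E].
Proof.
move=> cC cf Ca.
(* Pulling [f] back to the weights replaces the possibly degenerate simplex spanned by the [a i]
   with the standard one, where [l] is an interior point. *)
pose G (w : 'rV[R]_n.+1) := f (\sum_i w 0 i *: a i).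
have GE t : f (\sum_i bary t i *: a i) = G (bary_row t).
  by congr f; apply: eq_bigr => i _; rewrite mxE.
have Gle w : weights w -> G w <= \sum_i w 0 i * f (a i).
  by move=> [w0 w1]; have [] := jensen_sum cC cf w0 w1 Ca.
have cG : convex_on (@weights R n) G.
  move=> x y s [x0 x1] [y0 y1] s01.
  have [Cx _] := jensen_sum cC cf x0 x1 Ca; have [Cy _] := jensen_sum cC cf y0 y1 Ca.
  apply: le_trans (cf _ _ _ Cx Cy s01); rewrite le_eqVlt; apply/orP; left.
  apply/eqP; congr f; rewrite !scaler_sumr -big_split/=.
  by apply: eq_bigr => i _; rewrite !mxE [LHS]scalerDl !scalerA.
have GB w : weights w -> G w <= \sum_i `|f (a i)|.
  move=> Ww; apply: le_trans (Gle _ Ww) _; case: Ww => w0 w1.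
  apply: ler_sum => i _; apply: le_trans (ler_norm _) _.
  rewrite normrM ler_piMl// ger0_norm// -w1 (bigD1 i)//= lerDl.
  by apply: sumr_ge0.
have mS := @measurable_simplex R n.
have mG := measurable_convex_bary cG GB.
have [k [kl kG]] : exists k, \sum_i k i * (bary_row l) 0 i = G (bary_row l) /\
    forall w, weights w -> \sum_i k i * w 0 i <= G w.
  apply: weights_support => //; first by move=> i; rewrite mxE bary_gt0.
  by rewrite -[RHS](sum_bary l); apply: eq_bigr => i _; rewrite mxE.
have [intk intkE] := mu_lambda_linear n0 hl k.
have [intf intfE] := mu_lambda_linear n0 hl (f \o a).
have kle t : simplex n t -> \sum_i k i * bary t i <= G (bary_row t).
  move=> /weights_bary/kG; under eq_bigr do rewrite mxE; exact.
have fge t : simplex n t -> G (bary_row t) <= \sum_i (f \o a) i * bary t i.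
  move=> /weights_bary/Gle; under eq_bigr do rewrite mxE mulrC; exact.
under eq_fun do rewrite GE.
(* Lying between two integrable linear forms, [G] is dominated by the sum of their absolute
   values. *)
have intG : (mu_lambda hl).-integrable (simplex n) (fun t => (G (bary_row t))%:E).
  apply: (@le_integrable _ _ _ _ _ mS _ (fun t =>
    `|(\sum_i k i * bary t i)%:E| + `|(\sum_i (f \o a) i * bary t i)%:E|)%E).
  - exact/measurable_EFinP.
  - move=> t St; rewrite /= lee_fin [leRHS]ger0_norm ?addr_ge0//.
    have := kle _ St; have := fge _ St.
    move: (\sum_i k i * _) (\sum_i (f \o a) i * _) (G _) => u v g gv ug.
    have := ler_norm (- u); have := ler_norm v; rewrite normrN.
    have := normr_ge0 u; have := normr_ge0 v.
    by move=> *; rewrite ler_norml; apply/andP; split; lra.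
  - by apply: integrableD => //; exact: integrable_abse.
split => //.
- have -> : f (\sum_i bary l i *: a i) = \sum_i k i * bary l i.
    by rewrite GE -kl; apply: eq_bigr => i _; rewrite mxE.
  rewrite -intkE; apply: le_integral => // t /set_mem St.
  by rewrite lee_fin kle.
- rewrite (_ : \sum_i _ = \sum_i (f \o a) i * bary l i); last first.
    by apply: eq_bigr => i _; rewrite mulrC.
  rewrite -intfE; apply: le_integral => // t /set_mem St.
  by rewrite lee_fin fge.
Qed.

Theorem theorem3p3 (R : realType) (n : nat) (n_ge1 : (1 <= n)%N)
    (C : set 'rV[R]_n) (C_nonempty : C !=set0) (C_convex : convex_set C)
    (f : 'rV[R]_n -> R) (l : n.-tuple R) (hl : int_simplex n l) :
  mu_lambda hl (simplex n) = 1%E /\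
  (convex_function C f ->
    forall a : 'I_n.+1 -> 'rV[R]_n, (forall i, C (a i)) ->
    [/\ (mu_lambda hl).-integrable (simplex n)
          (fun t => (f (\sum_(i < n.+1) bary t i *: a i))%:E),
        ((f (\sum_(i < n.+1) bary l i *: a i))%:E <=
          \int[mu_lambda hl]_(t in simplex n)
            (f (\sum_(i < n.+1) bary t i *: a i))%:E)%E &
        (\int[mu_lambda hl]_(t in simplex n)
            (f (\sum_(i < n.+1) bary t i *: a i))%:E <=
          (\sum_(i < n.+1) bary l i * f (a i))%:E)%E]) /\
  (concave_function C f ->
    forall a : 'I_n.+1 -> 'rV[R]_n, (forall i, C (a i)) ->
    [/\ (mu_lambda hl).-integrable (simplex n)
          (fun t => (f (\sum_(i < n.+1) bary t i *: a i))%:E),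
        (\int[mu_lambda hl]_(t in simplex n)
            (f (\sum_(i < n.+1) bary t i *: a i))%:E <=
          (f (\sum_(i < n.+1) bary l i *: a i))%:E)%E &
        ((\sum_(i < n.+1) bary l i * f (a i))%:E <=
          \int[mu_lambda hl]_(t in simplex n)
            (f (\sum_(i < n.+1) bary t i *: a i))%:E)%E]).
Proof.
have cC := convex_set_segment_closed C_convex.
split; first exact: mu_lambda_simplex.
split => cf a Ca.
  exact: (mu_lambda_hermite_hadamard n_ge1 hl cC
    (convex_function_convex_on cf) Ca).
have mS := @measurable_simplex R n.
(* The concave case is the convex one for [- f], with each inequality reversed by negation. *)
have [intNf lo up] := mu_lambda_hermite_hadamard n_ge1 hl cC
  (concave_function_convex_on cf) Ca.
have intf : (mu_lambda hl).-integrable (simplex n)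
    (fun t => (f (\sum_(i < n.+1) bary t i *: a i))%:E).
  have := integrableZl mS (-1) intNf.
  by under eq_fun do rewrite -EFinM mulN1r opprK.
have E : (\int[mu_lambda hl]_(t in simplex n)
    (- f (\sum_(i < n.+1) bary t i *: a i))%:E =
    - \int[mu_lambda hl]_(t in simplex n)
      (f (\sum_(i < n.+1) bary t i *: a i))%:E)%E.
  under eq_integral do rewrite -mulN1r EFinM.
  by rewrite integralZl// EFinN mulN1e.
split => //.
- by rewrite -leeN2 -E -EFinN.
- rewrite -leeN2 -E -EFinN; apply: le_trans up _; rewrite lee_fin.
  by rewrite -sumrN; apply: ler_sum => i _; rewrite mulrN.
Qed.
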